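(* For every integer $d\geq 2$, the polynomial $r_d(x)\in\mathbb{Q}[x]$ (defined explicitly in the context) has degree $d$ and satisfies \[ r_d([d+6]) \subseteq \begin{cases} [d+5] & \text{if } d \text{ is even,}\\ [d+4] & \text{if } d \text{ is odd.}\end{cases} \]
   Context: For a positive integer $m$, $[m] := \{1,2,\ldots,m\}$. Let $\rho:\mathbb{Z}^2\to\mathbb{Z}$ be the unique function such that $\rho(m+3,d) = -\rho(m,d)$ and $\rho(m,d+1) = -\rho(m+1,d)$ for all $(m,d)\in\mathbb{Z}^2$, and $\rho(0,0)=\rho(1,0)=1$, $\rho(2,0)=0$. For $d\ge 0$, let $s_d(x)\in\mathbb{Q}[x]$ be the unique polynomial of degree at most $d$ such that $s_d\left(m-\tfrac{d+1}{2}\right)=\rho(m,d)$ for all integers $0\le m\le d$. For $d\geq 0$ define \[ r_d(x) := \begin{cases} s_d\left(x -3 - \tfrac{d+1}{2}\right) + 2 & \text{if } d \text{ is even,}\\ s_d\left(x - 3 - \tfrac{d+ 1}{2}\right) - x + d + 6& \text{if } d \text{ is odd.}\end{cases} \] *)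

(* Defs.v *)
From mathcomp Require Import all_boot all_order all_algebra zify ring lra.

Set Implicit Arguments.
Unset Strict Implicit.
Unset Printing Implicit Defensive.

Import Order.TTheory GRing.Theory Num.Theory.
Local Open Scope ring_scope.

Definition rho_spec (f : int -> int -> int) : Prop :=
  [/\ forall m d, f (m + 3) d = - f m d,
      forall m d, f m (d + 1) = - f (m + 1) d
    & [/\ f 0 0 = 1, f 1 0 = 1 & f 2 0 = 0]].

Lemma rho_spec_unique (f g : int -> int -> int) :
  rho_spec f -> rho_spec g -> forall m d, f m d = g m d.
Proof.
move=> [f3 fd [f0 f1 f2]] [g3 gd [g0 g1 g2]].
have base (m : int) : f m 0 = g m 0.
  have step k (i : int) : f i 0 = g i 0 ->
      f (i + 3 * k%:Z) 0 = g (i + 3 * k%:Z) 0 /\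
      f (i - 3 * k%:Z) 0 = g (i - 3 * k%:Z) 0.
    move=> ei; elim: k => [|k [IH1 IH2]]; first by rewrite (_ : 3 * 0%:Z = 0) // !addr0 ?subr0.
    split.
      have -> : i + 3 * k.+1%:Z = (i + 3 * k%:Z) + 3 by lia.
      by rewrite f3 g3 IH1.
    have := f3 (i - 3 * k.+1%:Z) 0; have := g3 (i - 3 * k.+1%:Z) 0.
    have -> : i - 3 * k.+1%:Z + 3 = i - 3 * k%:Z by lia.
    by rewrite IH2 => -> /oppr_inj ->.
  have e (i : int) : f i 0 = g i 0 -> forall q : int,
      f (i + 3 * q) 0 = g (i + 3 * q) 0.
    move=> ei q; case: (step `|q|%N i ei) => h1 h2.
    have [q0|q0] := leP 0 q.
      by have -> : 3 * q = 3 * `|q|%N%:Z by lia.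
    by have -> : i + 3 * q = i - 3 * `|q|%N%:Z by lia.
  have E := divz_eq m 3.
  have : (m %% 3)%Z = 0 \/ (m %% 3)%Z = 1 \/ (m %% 3)%Z = 2 by lia.
  by case=> [r|[r|r]]; rewrite E r addrC mulrC; apply: e; congruence.
have up (k : nat) : forall m, f m k = g m k.
  elim: k => [|k IH] m; first exact: base.
  have -> : k.+1%:Z = k%:Z + 1 by lia.
  by rewrite fd gd IH.
have dn (k : nat) : forall m, f m (- k%:Z) = g m (- k%:Z).
  elim: k => [|k IH] m; first exact: base.
  have := fd (m - 1) (- k.+1%:Z); have := gd (m - 1) (- k.+1%:Z).
  have -> : - k.+1%:Z + 1 = - k%:Z by lia.
  by rewrite subrK IH => -> /oppr_inj ->.
move=> m d; have [d0|d0] := leP 0 d.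
  by have -> : d = `|d|%N%:Z by lia.
by have -> : d = - `|d|%N%:Z by lia.
Qed.

Lemma rho_exists : {f : int -> int -> int | rho_spec f}.
Proof.
pose a (n : int) : int :=
  if (n %% 3)%Z == 2 then 0 else if (n %% 6)%Z <= 1 then 1 else -1.
exists (fun m d => (if (d %% 2)%Z == 0 then 1 else -1) * a (m + d)).
have a3 n : a (n + 3) = - a n.
  rewrite /a.
  by repeat (case: ifP => ?); lia.
split=> [m d|m d|//].
  by rewrite -mulrN -a3 addrAC.
rewrite -mulNr (addrC d 1) (addrA m 1 d); congr (_ * _).
by repeat (case: ifP => ?); lia.
Qed.

(* The witness is opaque: rho is known only through rhoP, which determines it
   by rho_spec_unique. The same goes for s below, with sP and s_spec_unique. *)
Definition rho : int -> int -> int := sval rho_exists.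

Lemma rhoP : rho_spec rho.
Proof. exact: (svalP rho_exists). Qed.

Definition s_spec (d : nat) (p : {poly rat}) : Prop :=
  (size p <= d.+1)%N /\
  forall m : nat, (m <= d)%N ->
    p.[m%:R - d.+1%:R / 2] = (rho m d)%:~R.

Lemma s_spec_unique (d : nat) (p q : {poly rat}) :
  s_spec d p -> s_spec d q -> p = q.
Proof.
move=> [sp hp] [sq hq]; apply/eqP; rewrite -subr_eq0; apply/eqP.
pose t := [seq m%:R - d.+1%:R / 2 : rat | m <- iota 0 d.+1].
apply: (@roots_geq_poly_eq0 _ _ t).
- apply/allP=> y /mapP [m]; rewrite mem_iota => /andP [_ hm] ->.
  by rewrite rootE !hornerE hp // hq // subrr.
- rewrite map_inj_uniq ?iota_uniq // => m n /addIr /eqP.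
  by rewrite eqr_nat => /eqP.
- rewrite size_map size_iota; apply: leq_trans (size_polyD _ _) _.
  by rewrite size_polyN geq_max sp.
Qed.

Lemma s_exists (d : nat) : {p : {poly rat} | s_spec d p}.
Proof.
pose x (m : nat) : rat := m%:R - d.+1%:R / 2.
have xI m n : x m = x n -> m = n.
  by move=> /addIr /eqP; rewrite eqr_nat => /eqP.
suff H k : {p : {poly rat} | (size p <= k)%N /\
    forall m : nat, (m < k)%N -> p.[x m] = (rho m d)%:~R} by exact: H d.+1.
elim: k => [|k [p [sp hp]]]; first by exists 0; rewrite size_poly0.
pose w : {poly rat} := \prod_(i < k) ('X - (x i)%:P).
have wE y : w.[y] = \prod_(i < k) (y - x i).
  by rewrite horner_prod; apply: eq_bigr => i _; rewrite !hornerE.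
have wk : w.[x k] != 0.
  rewrite wE; apply/prodf_neq0 => i _; rewrite subr_eq0.
  by apply/eqP => /xI e; have := ltn_ord i; rewrite -e ltnn.
exists (p + (((rho k d)%:~R - p.[x k]) / w.[x k]) *: w); split.
  apply: leq_trans (size_polyD _ _) _; rewrite geq_max (leq_trans sp) //=.
  apply: leq_trans (size_scale_leq _ _) _.
  by rewrite size_prod_XsubC /index_enum -enumT size_enum_ord.
move=> m; rewrite ltnS leq_eqVlt => /orP [/eqP ->|mk].
  by rewrite !hornerE divfK // addrC subrK.
have w0 : w.[x m] = 0.
  by rewrite wE (bigD1 (Ordinal mk)) //= subrr mul0r.
by rewrite !hornerE w0 mulr0 addr0 hp.
Qed.

Definition s (d : nat) : {poly rat} := sval (s_exists d).

Lemma sP (d : nat) : s_spec d (s d).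
Proof. exact: (svalP (s_exists d)). Qed.

Definition r (d : nat) : {poly rat} :=
  let sd := s d \Po ('X - (3 + d.+1%:R / 2)%:P) in
  if ~~ odd d then sd + 2%:P else sd - 'X + (d + 6)%:R%:P.

(* [m] = {1, ..., m}, embedded in the rationals, since it is used both for the
   arguments and for the values of a polynomial over rat. *)
Definition brack (m : nat) : seq rat := [seq k%:R | k <- iota 1 m].

(* Main.v *)
(* Let p_d(m) = s_d(m - (d+1)/2) and a(n) = rho(n,0), so that rho(m,d) = (-1)^d a(m+d) and
   a(n+2) = a(n+1) - a(n).  Then p_{d+1}(m+1) - p_{d+1}(m) and p_d(m) are polynomials
   of degree at most d that agree at m = 0, ..., d, hence they are equal.  This gives
   deg p_d = d, and it determines the five values of p_d needed outside 0, ..., d by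
   induction on d:
     p_d(d+1) = a(d),  p_d(d+2) = 1 - a(d+2),  p_d(d+3) = d + 2 - a(d+1),
     p_d(-1) = (-1)^d p_d(d+2),  p_d(-2) = (-1)^d p_d(d+3).
   Since |a| <= 1, the required bounds follow. *)
Require Import Defs.
From mathcomp Require Import all_boot all_order all_algebra.
From mathcomp Require Import zify ring.

Import Order.TTheory GRing.Theory Num.Theory.
Local Open Scope ring_scope.

(** * Shifts of polynomials, and equality tested at natural points *)

Lemma lead_coef_comp_polyXDC (R : idomainType) (p : {poly R}) (c : R) :
  lead_coef (p \Po ('X + c%:P)) = lead_coef p.
Proof.
by rewrite lead_coef_comp ?size_XaddC // lead_coefXaddC expr1n mulr1.
Qed.

Lemma size_comp_polyXDC (R : idomainType) (p : {poly R}) (c : R) :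
  size (p \Po ('X + c%:P)) = size p.
Proof. by rewrite size_comp_poly2 // size_XaddC. Qed.

(** A shift preserves the size and the leading coefficient, so the top terms cancel. *)
Lemma size_poly_shift_sub (R : idomainType) (p : {poly R}) (c : R) (n : nat) :
  (size p <= n.+1)%N -> (size (p \Po ('X + c%:P) - p)%R <= n)%N.
Proof.
move=> sp; apply/leq_sizeP => j nj; rewrite coefB.
have [jp|pj] := ltnP j (size p); last first.
  by rewrite !nth_default ?subrr ?size_comp_polyXDC.
have {}jp : size p = j.+1 by lia.
have := lead_coef_comp_polyXDC _ p c.
by rewrite /lead_coef size_comp_polyXDC jp /= => ->; rewrite subrr.
Qed.

(** The points 0, ..., n-1 are distinct in a [numDomainType], so [p - q] has [n] roots and size at
    most [n], hence vanishes. *)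
Lemma poly_eq_nat (R : numDomainType) (p q : {poly R}) (n : nat) :
  (size p <= n)%N -> (size q <= n)%N ->
  (forall m : nat, (m < n)%N -> p.[m%:R] = q.[m%:R]) -> p = q.
Proof.
move=> sp sq pq; apply/eqP; rewrite -subr_eq0; apply/eqP.
apply: (@roots_geq_poly_eq0 _ _ [seq m%:R : R | m <- iota 0 n]).
- apply/allP => y /mapP [m]; rewrite mem_iota => /andP [_ mn] ->.
  by rewrite rootE !hornerE pq // subrr.
- by rewrite map_inj_uniq ?iota_uniq // => m k /eqP; rewrite eqr_nat => /eqP.
- rewrite size_map size_iota (leq_trans (size_polyD _ _)) //.
  by rewrite size_polyN geq_max sp.
Qed.

(** * The sequence a of the overview: 1, 1, 0, -1, -1, 0, with period 6 *)

Definition rho0 (n : nat) : int := rho n 0.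

Lemma rho0_add3 (n : nat) : rho0 n.+3 = - rho0 n.
Proof. by have [H _ _] := rhoP; rewrite /rho0 -H; congr (rho _ _); lia. Qed.

Lemma rho0_init : [/\ rho0 0 = 1, rho0 1 = 1 & rho0 2 = 0].
Proof. by have [_ _] := rhoP. Qed.

(** Both sides change sign when [n] grows by 3, so the cases 0, 1, 2 decide. *)
Lemma rho0_rec (n : nat) : rho0 n.+2 = rho0 n.+1 - rho0 n.
Proof.
have [a0 a1 a2] := rho0_init.
elim/ltn_ind: n => -[|[|[|n]]] IH; rewrite ?rho0_add3 ?a0 ?a1 ?a2 //.
by rewrite IH; lia.
Qed.

Lemma rho0_bound (n : nat) : -1 <= rho0 n <= 1.
Proof.
have [a0 a1 a2] := rho0_init.
elim/ltn_ind: n => -[|[|[|n]]] IH; rewrite ?rho0_add3 ?a0 ?a1 ?a2 //.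
by have := IH n; lia.
Qed.

(** Each unit of [d] is traded for a unit of [m] at the cost of a sign. *)
Lemma rhoE (m d : nat) : rho m d = (-1) ^+ d * rho0 (m + d).
Proof.
elim: d m => [|d IH] m; first by rewrite mul1r addn0.
have [_ H _] := rhoP.
have -> : d.+1%:Z = d%:Z + 1 by lia.
have := IH m.+1; have -> : m.+1%:Z = m%:Z + 1 by lia.
by rewrite H => ->; rewrite addSnnS exprS mulN1r mulNr.
Qed.

(** * The polynomials p_d of the overview, with nodes moved to 0, ..., d *)

Definition shifted_s (d : nat) : {poly rat} := s d \Po ('X - (d.+1%:R / 2)%:P).

Lemma shifted_s_horner (d : nat) (x : rat) :
  (shifted_s d).[x] = (s d).[x - d.+1%:R / 2].
Proof. by rewrite horner_comp !hornerE. Qed.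

Lemma shifted_s_nat (d m : nat) : (m <= d)%N ->
  (shifted_s d).[m%:R] = (-1) ^+ d * (rho0 (m + d))%:~R.
Proof.
move=> md; have [_ H] := sP d.
by rewrite shifted_s_horner H // rhoE rmorphM rmorphXn /= rmorphN1.
Qed.

Lemma size_shifted_s_leq (d : nat) : (size (shifted_s d) <= d.+1)%N.
Proof. by have [H _] := sP d; rewrite /shifted_s -polyCN size_comp_polyXDC. Qed.

Lemma shifted_s_diff (d : nat) :
  shifted_s d.+1 \Po ('X + 1%:P) - shifted_s d.+1 = shifted_s d.
Proof.
apply: (@poly_eq_nat _ _ _ d.+1).
- exact/size_poly_shift_sub/size_shifted_s_leq.
- exact: size_shifted_s_leq.
move=> m md; rewrite !hornerE horner_comp !hornerE natr1.
(* Since m <= d, both m and m+1 are nodes for d+1; the recurrence turns the difference of the [rho0]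
   values into -rho0(m+d). *)
rewrite !shifted_s_nat ?(ltnW md) // !addSn !addnS rho0_rec.
by rewrite exprS rmorphB /=; ring.
Qed.

Lemma shifted_s_step (d : nat) (x : rat) :
  (shifted_s d.+1).[x + 1] = (shifted_s d.+1).[x] + (shifted_s d).[x].
Proof.
rewrite -[in RHS](shifted_s_diff d) hornerD hornerN [(_ \Po ('X + _)).[_]]horner_comp.
by rewrite hornerD hornerX hornerC; ring.
Qed.

Lemma shifted_s0 : shifted_s 0 = 1.
Proof.
apply: (@poly_eq_nat _ _ _ 1); rewrite ?size_shifted_s_leq ?size_poly1 //.
case=> // _; rewrite shifted_s_nat // mul1r.
by have [-> _ _] := rho0_init; rewrite hornerC.
Qed.

Lemma size_shifted_s (d : nat) : size (shifted_s d) = d.+1.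
Proof.
elim: d => [|d IH]; first by rewrite shifted_s0 size_poly1.
(* If the degree dropped, the difference [shifted_s d] would have size at most [d], against the
   induction hypothesis. *)
apply/eqP; rewrite eqn_leq size_shifted_s_leq ltnNge; apply/negP => H.
by have := size_poly_shift_sub _ _ 1 _ H; rewrite shifted_s_diff IH ltnn.
Qed.

(** * Values at the five points outside the nodes *)

Lemma rho0_double (d : nat) : (-1) ^+ d * rho0 (d + d) = rho0 d.+1.
Proof.
have [a0 a1 a2] := rho0_init.
elim/ltn_ind: d => -[|[|[|d]]] IH.
1-3: by rewrite ?rho0_add3 ?a0 ?a1 ?a2.
(* Raising [d] by 3 negates both sides; on the left only the sign changes, as [rho0] has period
   6. *)
have -> : (d.+3 + d.+3 = (d + d).+3.+3)%N by lia.
by rewrite !rho0_add3 -IH ?exprS; [ring | lia].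
Qed.

Lemma shifted_s_right1 (d : nat) :
  (shifted_s d).[d%:R + 1] = (rho0 d)%:~R.
Proof.
have [a0 _ _] := rho0_init.
elim: d => [|d IH]; first by rewrite shifted_s0 hornerE a0.
rewrite shifted_s_step shifted_s_nat // -[in (shifted_s d).[_]]natr1 IH.
(* This is the value at the last node d+1, where [rho0_double] absorbs the sign. *)
have -> : (-1) ^+ d.+1 * (rho0 (d.+1 + d.+1))%:~R = (rho0 d.+2)%:~R :> rat.
  by rewrite -rho0_double rmorphM rmorphXn /= rmorphN1.
by rewrite rho0_rec rmorphB /= subrK.
Qed.

(** By the difference equation, p_{d+1}(d+3) = p_{d+1}(d+2) + p_d(d+2): the first term is
    [shifted_s_right1], the second the induction hypothesis. *)
Lemma shifted_s_right2 (d : nat) :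
  (shifted_s d).[d%:R + 2] = 1 - (rho0 d.+2)%:~R.
Proof.
have [a0 a1 a2] := rho0_init.
elim: d => [|d IH]; first by rewrite shifted_s0 hornerE a2.
have -> : d.+1%:R + 2 = d.+1%:R + 1 + 1 :> rat by ring.
rewrite shifted_s_step shifted_s_right1.
have -> : d.+1%:R + 1 = d%:R + 2 :> rat by rewrite -natr1; ring.
by rewrite IH rho0_add3 rho0_rec !(rmorphB, rmorphN) /=; ring.
Qed.

Lemma shifted_s_right3 (d : nat) :
  (shifted_s d).[d%:R + 3] = d%:R + 2 - (rho0 d.+1)%:~R.
Proof.
have [a0 a1 a2] := rho0_init.
elim: d => [|d IH]; first by rewrite shifted_s0 hornerE a1.
have -> : d.+1%:R + 3 = d.+1%:R + 2 + 1 :> rat by ring.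
rewrite shifted_s_step shifted_s_right2.
have -> : d.+1%:R + 2 = d%:R + 3 :> rat by rewrite -natr1; ring.
by rewrite IH rho0_add3 rho0_rec -natr1 !(rmorphB, rmorphN) /=; ring.
Qed.

Lemma shifted_s_left1 (d : nat) :
  (shifted_s d).[-1] = (-1) ^+ d * (1 - (rho0 d.+2)%:~R).
Proof.
have [a0 a1 a2] := rho0_init.
elim: d => [|d IH]; first by rewrite shifted_s0 hornerE a2 expr0; ring.
(* The difference equation is solved backwards for p_{d+1}(-1) from the known value at the node
   0. *)
have := shifted_s_step d (-1); have := shifted_s_nat d.+1 0 isT.
rewrite addNr add0n mulr0n => -> /eqP.
rewrite -subr_eq => /eqP <-.
by rewrite IH rho0_add3 rho0_rec exprS !(rmorphB, rmorphN) /=; ring.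
Qed.

Lemma shifted_s_left2 (d : nat) :
  (shifted_s d).[-2] = (-1) ^+ d * (d%:R + 2 - (rho0 d.+1)%:~R).
Proof.
have [a0 a1 a2] := rho0_init.
elim: d => [|d IH]; first by rewrite shifted_s0 hornerE a1 expr0; ring.
have := shifted_s_step d (-2); have -> : -2 + 1 = -1 :> rat by ring.
rewrite shifted_s_left1 => /eqP; rewrite -subr_eq => /eqP <-.
by rewrite IH rho0_add3 rho0_rec exprS -natr1 !(rmorphB, rmorphN) /=; ring.
Qed.

(** * Degree and values of [r d] *)

Lemma r_shifted_s (d : nat) :
  r d = (shifted_s d \Po ('X - 3%:P)) +
    (if ~~ odd d then 2%:P else (d + 6)%:R%:P - 'X).
Proof.
have E : s d \Po ('X - (3 + d.+1%:R / 2)%:P) = shifted_s d \Po ('X - 3%:P).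
  rewrite /shifted_s -comp_polyA comp_polyB comp_polyX comp_polyC.
  by rewrite polyCD opprD addrA.
by rewrite /r E; case: ifP => // _; rewrite addrAC -addrA.
Qed.

Lemma size_r (d : nat) : (2 <= d)%N -> size (r d) = d.+1.
Proof.
move=> d2; have sd : size (shifted_s d \Po ('X - 3%:P)) = d.+1.
  by rewrite -polyCN size_comp_polyXDC size_shifted_s.
(* The added term has degree at most 1, below d since d >= 2. *)
rewrite r_shifted_s size_polyDl sd // ltnS.
case: ifP => _; first by rewrite (leq_trans (size_polyC_leq1 _)) // ltnW.
rewrite -opprB size_polyN; apply: leq_trans d2.
by rewrite size_XsubC.
Qed.

Lemma r_horner (d : nat) (x : rat) :
  (r d).[x] = (shifted_s d).[x - 3] +
    (if ~~ odd d then 2 else (d + 6)%:R - x).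
Proof.
by rewrite r_shifted_s hornerD horner_comp; case: ifP; rewrite !hornerE.
Qed.

Lemma mem_brackP (n : nat) (x : rat) :
  reflect (exists2 k : nat, (1 <= k <= n)%N & x = k%:R) (x \in brack n).
Proof.
by apply: (iffP mapP) => -[k kn ->]; exists k => //; move: kn;
   rewrite mem_iota; lia.
Qed.

Lemma mem_brack_int (n : nat) (v : int) :
  1 <= v <= n%:Z -> v%:~R \in brack n.
Proof.
by move=> vn; apply/mem_brackP; exists `|v|%N; [lia | case: v vn].
Qed.

Theorem theorem1p10 (d : nat) (hd : (2 <= d)%N) :
  size (r d) = d.+1 /\
  forall x : rat, x \in brack (d + 6) ->
    (r d).[x] \in brack (if ~~ odd d then (d + 5)%N else (d + 4)%N).
Proof.
split=> [|x /mem_brackP [k kd ->]]; first exact: size_r.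
suff [v ev vd] : exists2 v : int, (shifted_s d).[k%:R - 3] = v%:~R &
    1 <= v + (if ~~ odd d then 2 else (d + 6)%:Z - k%:Z) <=
      (if ~~ odd d then (d + 5)%N else (d + 4)%N)%:Z.
  rewrite r_horner ev.
  have -> : v%:~R + (if ~~ odd d then 2 else (d + 6)%:R - k%:R) =
      (v + (if ~~ odd d then 2 else (d + 6)%:Z - k%:Z))%:~R :> rat.
    by rewrite [RHS]rmorphD; case: ifP => // _; rewrite rmorphB.
  exact: mem_brack_int _ _ vd.
have sgn (w : int) :
    (-1) ^+ d * w%:~R = (if odd d then - w else w)%:~R :> rat.
  by rewrite -signr_odd; case: odd; rewrite ?mulN1r ?mul1r ?rmorphN.
have b1 := rho0_bound d; have b2 := rho0_bound d.+1.
have b3 := rho0_bound d.+2.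
have natE (m : nat) : k = (m + 3)%N -> k%:R - 3 = m%:R :> rat.
  by move=> ->; rewrite natrD addrK.
(* The argument k - 3 runs over -2, -1, the nodes 0, ..., d, then d+1, d+2, d+3. *)
have cases : [\/ k = 1%N, k = 2%N | [\/ (3 <= k <= d + 3)%N,
    k = (d.+1 + 3)%N, k = (d.+2 + 3)%N | k = (d.+3 + 3)%N]].
  have [k1|k1] := eqVneq k 1%N; first by constructor 1.
  have [k2|k2] := eqVneq k 2%N; first by constructor 2.
  constructor 3; have [k3|k3] := leqP k (d + 3); first by constructor 1; lia.
  have [k4|k4] := eqVneq k (d.+1 + 3)%N; first by constructor 2.
  have [k5|k5] := eqVneq k (d.+2 + 3)%N; first by constructor 3.
  by constructor 4; lia.
case: cases => [k1|k2|[k3|k4|k5|k6]].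
(* For odd d the linear term d+5 cancels the growth and leaves 3 + rho0(d+1); for even d the total
   is d+4 - rho0(d+1), at most d+5. *)
- exists (if odd d then - (d%:Z + 2 - rho0 d.+1) else d%:Z + 2 - rho0 d.+1).
    rewrite k1 -sgn rmorphB rmorphD /=.
    by rewrite (_ : 1 - 3 = -2) // shifted_s_left2.
  by case: odd => /=; lia.
- exists (if odd d then - (1 - rho0 d.+2) else 1 - rho0 d.+2).
    rewrite k2 -sgn rmorphB /=.
    by rewrite (_ : 2 - 3 = -1) // shifted_s_left1.
  by case: odd => /=; lia.
(* For odd d, the term d+6-k lies between 3 and d+3, which leaves room for a value of absolute value
   at most 1. *)
- exists (if odd d then - rho0 (k - 3 + d) else rho0 (k - 3 + d)).
    by rewrite -sgn (natE (k - 3)%N) ?shifted_s_nat //; lia.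
  by have := rho0_bound (k - 3 + d); case: odd => /=; lia.
- exists (rho0 d); last by case: odd => /=; lia.
  by rewrite (natE _ k4) -natr1 shifted_s_right1.
- exists (1 - rho0 d.+2); last by case: odd => /=; lia.
  by rewrite (natE _ k5) -[in (shifted_s d).[_]]addn2 natrD shifted_s_right2 rmorphB.
- exists (d%:Z + 2 - rho0 d.+1); last by case: odd => /=; lia.
  by rewrite (natE _ k6) -[in (shifted_s d).[_]]addn3 natrD shifted_s_right3 rmorphB rmorphD.
Qed.
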